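(* Let $D_1,\dots,D_\ell\in\mathbb{C}^{m\times n}$ with $mn>\ell$, and let $$A=[\mathrm{vec}(D_1),\dots,\mathrm{vec}(D_\ell)]\in\mathbb{C}^{mn\times\ell},\qquad \mathcal{A}\in\mathbb{C}^{m\times\ell\times n},\quad \mathcal{A}_{i,j,k}=(D_j)_{i,k}.$$ Let $M\in\mathbb{C}^{n\times n}$ be a non-zero multiple of a unitary matrix, let $r$ be the rank of $A$ and $t$ the t-rank of $\mathcal{A}$ under $\star_M$. For $k\le r$, let $A_k$ denote the best rank-$k$ matrix approximation to $A$ in the Frobenius norm, and let $\mathcal{A}_k$ denote the best t-rank-$k$ tensor approximation to $\mathcal{A}$ under $\star_M$ in the Frobenius norm. Then $$\|\mathcal{S}_{k+1:t,\,k+1:t,\,:}\|_F=\|\mathcal{A}-\mathcal{A}_k\|_F\le\|A-A_k\|_F,$$ where $\mathcal{S}$ is the f-diagonal factor in the t-SVDM of $\mathcal{A}$ under $\star_M$.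
   Context: MATLAB index notation is used; $\mathrm{vec}$ stacks columns. $\|\cdot\|_F$ is the Frobenius norm (square root of the sum of squared moduli of all entries) for matrices and tensors. For an invertible $n\times n$ matrix $M$ and a tensor $\mathcal{A}$ with third dimension $n$, $\widehat{\mathcal{A}}=\mathcal{A}\times_3 M$ is given by $\widehat{\mathcal{A}}_{i,j,k}=\sum_{l}M_{kl}\mathcal{A}_{i,j,l}$. The product $\mathcal{C}=\mathcal{A}\star_M\mathcal{B}$ is defined by $\widehat{\mathcal{C}}_{:,:,i}=\widehat{\mathcal{A}}_{:,:,i}\widehat{\mathcal{B}}_{:,:,i}$ for $i=1,\dots,n$, and $\mathcal{C}=\widehat{\mathcal{C}}\times_3M^{-1}$; the conjugate transpose by $(\widehat{\mathcal{A}^{\rm H}})_{:,:,i}=(\widehat{\mathcal{A}}_{:,:,i})^{\rm H}$. The t-SVDM of $\mathcal{A}$ is $\mathcal{A}=\mathcal{U}\star_M\mathcal{S}\star_M\mathcal{V}^{\rm H}$, where for each $i$, $\widehat{\mathcal{A}}_{:,:,i}=\widehat{\mathcal{U}}_{:,:,i}\widehat{\mathcal{S}}_{:,:,i}\widehat{\mathcal{V}}_{:,:,i}^{\rm H}$ is a matrix SVD with singular values in non-increasing order on the diagonal, and $\mathcal{U},\mathcal{S},\mathcal{V}$ are obtained by applying $\times_3M^{-1}$; each frontal slice of $\mathcal{S}$ is diagonal (f-diagonal). The t-rank is the number of non-zero tubes $\mathcal{S}_{i,i,:}$. The best t-rank-$k$ approximation $\mathcal{A}_k$ is the minimizer of $\|\mathcal{A}-\mathcal{C}\|_F$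 over tensors $\mathcal{C}=\mathcal{X}\star_M\mathcal{Y}$ with $\mathcal{X}\in\mathbb{C}^{m\times k\times n}$, $\mathcal{Y}\in\mathbb{C}^{k\times\ell\times n}$, given by the truncation $\mathcal{A}_k=\mathcal{U}_{:,1:k,:}\star_M\mathcal{S}_{1:k,1:k,:}\star_M\mathcal{V}_{:,1:k,:}^{\rm H}$ (so $\mathcal{A}_k=\mathcal{A}$ if $k\ge t$, in which case the block $\mathcal{S}_{k+1:t,k+1:t,:}$ is empty with norm $0$). *)

(* Defs.v *)
From HB Require Import structures.
From mathcomp Require Import all_boot all_order all_algebra.
From mathcomp Require Import complex.
From mathcomp Require Import reals.

Set Implicit Arguments.
Unset Strict Implicit.
Unset Printing Implicit Defensive.

Import Order.TTheory GRing.Theory Num.Theory.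

Local Open Scope ring_scope.
Local Open Scope sesquilinear_scope.

(* An m x p x n tensor is the family of its n frontal slices, so that the
   entry (i, j, k) of T is [T k i j]; the zmodule structure is entrywise. *)
Notation tensor C m p n := {ffun 'I_n -> 'M[C]_(m, p)}.

Section Definitions.
Variable C : numClosedFieldType.

Definition fnorm (m p : nat) (B : 'M[C]_(m, p)) : C :=
  sqrtC (\sum_i \sum_j `|B i j| ^+ 2).

Definition tfnorm (m p n : nat) (T : tensor C m p n) : C :=
  sqrtC (\sum_k \sum_i \sum_j `|T k i j| ^+ 2).

(* [mxvec] lists the entries row by row, hence the transpose. *)
Definition vec (m n : nat) (D : 'M[C]_(m, n)) : 'cV[C]_(n * m) :=
  (mxvec D^T)^T.

Definition vec_matrix (m n l : nat) (D : 'I_l -> 'M[C]_(m, n)) :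
    'M[C]_(n * m, l) :=
  \matrix_(p, j) vec (D j) p 0.

Definition slice_tensor (m n l : nat) (D : 'I_l -> 'M[C]_(m, n)) :
    tensor C m l n :=
  [ffun k => \matrix_(i, j) D j i k].

Definition mode3 (m p n : nat) (T : tensor C m p n) (M : 'M[C]_n) :
    tensor C m p n :=
  [ffun k => \sum_l M k l *: T l].

Definition starM (m p q n : nat) (M : 'M[C]_n)
    (X : tensor C m p n) (Y : tensor C p q n) : tensor C m q n :=
  mode3 [ffun k => mode3 X M k *m mode3 Y M k] (invmx M).

Definition starM_adj (m p n : nat) (M : 'M[C]_n) (X : tensor C m p n) :
    tensor C p m n :=
  mode3 [ffun k => (mode3 X M k)^t*] (invmx M).

Definition is_svd (m p : nat) (B : 'M[C]_(m, p))
    (U : 'M[C]_m) (S : 'M[C]_(m, p)) (V : 'M[C]_p) : Prop :=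
  [/\ U \is unitarymx, V \is unitarymx, B = U *m S *m V^t*, is_diag_mx S
    & (forall (i : 'I_m) (j : 'I_p), i = j :> nat -> 0 <= S i j) /\
      (forall (i i' : 'I_m) (j j' : 'I_p), i = j :> nat -> i' = j' :> nat ->
         (i <= i')%N -> S i' j' <= S i j)].

Definition is_tsvdm (m p n : nat) (M : 'M[C]_n) (T : tensor C m p n)
    (U : tensor C m m n) (S : tensor C m p n) (V : tensor C p p n) : Prop :=
  T = starM M (starM M U S) (starM_adj M V) /\
  forall k, is_svd (mode3 T M k) (mode3 U M k) (mode3 S M k) (mode3 V M k).

Definition nonzero_diag_tubes (m p n : nat) (S : tensor C m p n) : nat :=
  #|[set ij : 'I_m * 'I_p | (ij.1 == ij.2 :> nat) &&
       [exists k, S k ij.1 ij.2 != 0]]|.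

Definition is_trank (m p n : nat) (M : 'M[C]_n) (T : tensor C m p n)
    (t : nat) : Prop :=
  exists (U : tensor C m m n) (S : tensor C m p n) (V : tensor C p p n),
    is_tsvdm M T U S V /\ nonzero_diag_tubes S = t.

Definition is_best_rank_approx (m p : nat) (B : 'M[C]_(m, p)) (k : nat)
    (Bk : 'M[C]_(m, p)) : Prop :=
  (\rank Bk <= k)%N /\
  forall X : 'M[C]_(m, p), (\rank X <= k)%N -> fnorm (B - Bk) <= fnorm (B - X).

Definition is_best_trank_approx (m p n : nat) (M : 'M[C]_n)
    (T : tensor C m p n) (k : nat) (Tk : tensor C m p n) : Prop :=
  (exists (X : tensor C m k n) (Y : tensor C k p n), Tk = starM M X Y) /\
  forall (X : tensor C m k n) (Y : tensor C k p n),
    tfnorm (T - Tk) <= tfnorm (T - starM M X Y).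

(* S_{a+1:b, a+1:b, :} in 1-based indexing, padded with zeros to the size
   of S, which does not affect its Frobenius norm. *)
Definition diag_block (m p n : nat) (a b : nat) (S : tensor C m p n) :
    tensor C m p n :=
  [ffun k => \matrix_(i, j)
     if (a <= i < b)%N && (a <= j < b)%N then S k i j else 0].

End Definitions.

(* Main.v *)
Require Import Defs.
From mathcomp Require Import all_boot all_order all_algebra.
From mathcomp Require Import complex.
From mathcomp Require Import reals.

Import Order.TTheory GRing.Theory Num.Theory.

Local Open Scope ring_scope.

(** The transform along the third mode turns the star product into n
    independent matrix products and, as M is c times a unitary matrix,
    multiplies squared Frobenius norms by |c|^2.  Both claims follow.

    Equality.  Best t-rank-k approximation splits into n independent best
    rank-k approximation problems, one per transformed frontal slice, so the
    Eckart-Young theorem ([eckart_young_ge], [eckart_young_truncation]) says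
    that the optimal squared error, times |c|^2, is the sum over the slices
    of the squared singular values of index at least k, counting from 0.
    That is the squared norm of the transformed block of S, except that the block stops at index
    t.  Nothing is lost there: t counts the nonzero tubes of some other
    t-SVDM, which bounds the rank of each transformed slice by t
    ([trank_bound]), and the Eckart-Young bound applied to the slice as an
    approximation of itself forces its singular values of index at least t
    to vanish ([svd_tail0]).

    Inequality.  Folding the columns of a matrix of rank at most k into
    lateral slices gives a tensor of the form X * Y with inner dimension k
    ([fold_starM]): if the matrix is P Q, all frontal slices of the folded
    tensor are P_b Q with the same right factor Q, and the transform acts on
    the P_b only.  Hence A_k competes in the tensor problem, with the same
    error.

    For the Eckart-Young lower bound: after unitary changes of basis, B becomes its diagonal factor S and Z a
    matrix of the same rank, still called Z.  If E is the orthogonal projector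
    onto the null space of Z, then
    |S - Z|^2 >= |(S - Z) E|^2 = |S E|^2 = sum_j sigma_j^2 E_jj, where the
    weights E_jj lie in [0, 1] and have sum p - rank Z >= p - k; such a
    weighted sum is least when the weights sit on the smallest sigma_j^2
    ([sum_tail_le_weighted]). *)

(** * Low-rank approximation of matrices *)

Section EckartYoung.
Local Open Scope sesquilinear_scope.
Set Implicit Arguments.
Unset Strict Implicit.
Variable C : numClosedFieldType.

Definition sqfnorm m p (B : 'M[C]_(m, p)) : C := \sum_i \sum_j `|B i j| ^+ 2.

Lemma sqfnorm_ge0 m p (B : 'M[C]_(m, p)) : 0 <= sqfnorm B.
Proof. by apply: sumr_ge0 => i _; apply: sumr_ge0 => j _; apply: exprn_ge0. Qed.

Lemma adjmxM m p q (A : 'M[C]_(m, p)) (B : 'M[C]_(p, q)) :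
  (A *m B)^t* = B^t* *m A^t*.
Proof. by rewrite trmx_mul map_mxM. Qed.

Lemma sqfnormE m p (B : 'M[C]_(m, p)) : sqfnorm B = \tr (B *m B^t*).
Proof.
apply: eq_bigr => i _; rewrite mxE; apply: eq_bigr => j _.
by rewrite !mxE normCK.
Qed.

Lemma sqfnorm_unitaryl m p (W : 'M[C]_m) (B : 'M[C]_(m, p)) :
  W \is unitarymx -> sqfnorm (W *m B) = sqfnorm B.
Proof.
move=> /unitarymxP /mulmx1C hW.
rewrite !sqfnormE adjmxM mxtrace_mulC mulmxA -(mulmxA _ _ W) hW mulmx1.
by rewrite mxtrace_mulC.
Qed.

Lemma sqfnorm_unitaryr m p (W : 'M[C]_p) (B : 'M[C]_(m, p)) :
  W \is unitarymx -> sqfnorm (B *m W) = sqfnorm B.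
Proof.
move=> /unitarymxP hW.
by rewrite !sqfnormE adjmxM mulmxA -(mulmxA B) hW mulmx1.
Qed.

Lemma sqfnormZ m p a (B : 'M[C]_(m, p)) : sqfnorm (a *: B) = `|a| ^+ 2 * sqfnorm B.
Proof.
rewrite /sqfnorm mulr_sumr; apply: eq_bigr => i _.
by rewrite mulr_sumr; apply: eq_bigr => j _; rewrite !mxE normrM exprMn.
Qed.

Definition sqcol m p (S : 'M[C]_(m, p)) (j : 'I_p) : C := \sum_i `|S i j| ^+ 2.

(** When S is the diagonal factor of an SVD this is the sum of the squares of
    all but the k largest singular values; column sums avoid singling out the
    diagonal entries of a rectangular matrix. *)
Definition sqtail m p (k : nat) (S : 'M[C]_(m, p)) : C :=
  \sum_(j < p | (k <= j)%N) sqcol S j.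

Lemma sqcol_ge0 m p (S : 'M[C]_(m, p)) j : 0 <= sqcol S j.
Proof. by apply: sumr_ge0 => i _; apply: exprn_ge0. Qed.

Lemma rank_factor m p k (A : 'M[C]_(m, p)) : (\rank A <= k)%N ->
  exists (P : 'M[C]_(m, k)) (Q : 'M[C]_(k, p)), A = P *m Q.
Proof.
move=> rA; exists (col_ebase A *m pid_mx (\rank A)).
exists (pid_mx (\rank A) *m row_ebase A).
by rewrite mulmxA -(mulmxA (col_ebase A)) pid_mx_id // mulmx_ebase.
Qed.

Lemma rank_diag_le m p t (S : 'M[C]_(m, p)) (I : {set 'I_m * 'I_p}) :
  (forall i j, S i j != 0 -> (i, j) \in I) -> (#|I| <= t)%N ->
  (\rank S <= t)%N.
Proof.
move=> SI; apply: leq_trans; rewrite [S]matrix_sum_delta pair_bigA /=.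
rewrite (bigID (mem I)) /= [X in _ + X]big1 ?addr0 => [|[i j] /=]; last first.
  move=> nI; suff -> : S i j = 0 by rewrite scale0r.
  by apply/eqP; apply: contraNT nI => /SI.
rewrite -sum1_card; elim/big_rec2: _ => [|ij r A _ ih]; first by rewrite mxrank0.
apply: leq_trans (mxrank_add _ _) (leq_add _ ih).
by apply: leq_trans (mxrank_scale _ _) _; rewrite mxrank_delta.
Qed.

(** Weights in [0, 1] of total mass at least p - k cannot beat the 0/1 weights
    on the p - k smallest terms: replacing d by d - d_k, every term of the
    difference of the two sums becomes nonnegative, and the change costs
    d_k times the excess mass. *)
Lemma sum_tail_le_weighted p k (d e : 'I_p -> C) :
  (forall j, 0 <= d j) ->
  (forall j j' : 'I_p, (j <= j')%N -> d j' <= d j) ->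
  (forall j, 0 <= e j <= 1) -> (p - k)%N%:R <= \sum_j e j ->
  \sum_(j < p | (k <= j)%N) d j <= \sum_j d j * e j.
Proof.
move=> d0 dmono e01 se.
have [lkp|lepk] := ltnP k p; last first.
  rewrite big_pred0 => [|j].
    2: by apply/negbTE; rewrite -ltnNge (leq_trans _ lepk).
  by apply: sumr_ge0 => j _; rewrite mulr_ge0 //; case/andP: (e01 j).
pose dk := d (Ordinal lkp).
have card : \sum_(j < p | (k <= j)%N) (1 : C) = (p - k)%N%:R.
  by rewrite -(big_geq_mkord k p xpredT (fun=> 1 : C)) sumr_const_nat.
(* Both factors change sign at index k. *)
have : 0 <= \sum_j (d j - dk) * (e j - (k <= j)%N%:R).
  apply: sumr_ge0 => j _; case/andP: (e01 j) => e0 e1.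
  have [lekj|ltjk] := leqP k j.
    rewrite -mulrNN mulr_ge0 ?opprB ?subr_ge0 //; exact: dmono.
  by rewrite subr0 mulr_ge0 // subr_ge0; apply: dmono; apply: ltnW.
have -> : \sum_j (d j - dk) * (e j - (k <= j)%N%:R) =
   \sum_j d j * e j - \sum_(j < p | (k <= j)%N) d j
   - dk * (\sum_j e j - (p - k)%N%:R).
  rewrite -card !(big_mkcond (fun j : 'I_p => (k <= j)%N)) /=.
  rewrite -!sumrB mulr_sumr -sumrB; apply: eq_bigr => j _.
  by case: leqP => _ /=; [rewrite mulrBl mulrBr mulr1 | rewrite !subr0 mulrBl].
move=> h; rewrite -subr_ge0; apply: le_trans h _.
by rewrite lerBlDr lerDl mulr_ge0 ?subr_ge0 ?d0.
Qed.

(** The projector onto the null space of Z is 1 - Q^* Q, where the rows of Q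
    form an orthonormal basis of the row space of Z. *)
Lemma row_null_projector m p (Z : 'M[C]_(m, p)) :
  exists E : 'M[C]_p, [/\ E^t* = E, E *m E = E, Z *m E = 0
    & \tr E = (p - \rank Z)%N%:R].
Proof.
have rp := rank_leq_col Z.
pose Q := schmidt (row_base Z).
have /unitarymxP QQ : Q \is unitarymx by apply: schmidt_unitarymx.
have [X ZE] : exists X, Z = X *m Q.
  apply/submxP; rewrite -(eq_row_base Z); exact: schmidt_sub.
have adjP : (Q^t* *m Q)^t* = Q^t* *m Q by rewrite adjmxM trmxCK.
exists (1%:M - Q^t* *m Q); split.
- by rewrite linearB /= map_mxB trmx1 map_mx1 adjP.
- rewrite mulmxBl mul1mx mulmxBr mulmx1 mulmxA -(mulmxA _ Q) QQ mulmx1.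
  by rewrite subrr subr0.
- transitivity (X *m Q *m (1%:M - Q^t* *m Q)); first by congr (_ *m _).
  by rewrite mulmxBr mulmx1 mulmxA -(mulmxA X) QQ mulmx1 subrr.
- by rewrite linearB /= mxtrace1 mxtrace_mulC QQ mxtrace1 natrB.
Qed.

(** For an orthogonal projector E, Z E E^* Z^* collapses to Z E Z^*, which makes
    the squared norm of Z E linear in E. *)
Lemma sqfnorm_projE p (E : 'M[C]_p) : E^t* = E -> E *m E = E ->
  forall m (Z : 'M[C]_(m, p)), sqfnorm (Z *m E) = \tr (Z *m E *m Z^t*).
Proof.
by move=> Eadj Eidem m Z; rewrite sqfnormE adjmxM Eadj mulmxA -(mulmxA Z) Eidem.
Qed.

Section OrthogonalProjector.
Variables (p : nat) (E : 'M[C]_p).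
Hypotheses (Eadj : E^t* = E) (Eidem : E *m E = E).

(** Pythagoras. *)
Lemma sqfnorm_proj_split m (Z : 'M[C]_(m, p)) :
  sqfnorm Z = sqfnorm (Z *m E) + sqfnorm (Z *m (1%:M - E)).
Proof.
have Fadj : (1%:M - E)^t* = 1%:M - E.
  by rewrite linearB /= map_mxB trmx1 map_mx1 Eadj.
have Fidem : (1%:M - E) *m (1%:M - E) = 1%:M - E.
  by rewrite mulmxBl mul1mx mulmxBr mulmx1 Eidem subrr subr0.
rewrite (sqfnorm_projE Eadj Eidem) (sqfnorm_projE Fadj Fidem) sqfnormE.
by rewrite -mxtraceD -mulmxDl -mulmxDr addrC subrK mulmx1.
Qed.

Lemma proj_diag j : 0 <= E j j <= 1.
Proof.
(* E j j is the squared norm of the projection of a unit vector. *)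
have ej : E j j = sqfnorm (row j (1%:M : 'M[C]_p) *m E).
  rewrite (sqfnorm_projE Eadj Eidem) -row_mul mul1mx /mxtrace big_ord1 mxE.
  rewrite (bigD1 j) //= big1 => [|i nij]; rewrite !mxE.
    by rewrite eqxx conjC1 mulr1 addr0.
  by rewrite eq_sym (negbTE nij) conjC0 mulr0.
have one : sqfnorm (row j (1%:M : 'M[C]_p)) = 1.
  rewrite /sqfnorm big_ord1 (bigD1 j) //= big1 => [|i nij]; rewrite !mxE.
    by rewrite eqxx normr1 expr1n addr0.
  by rewrite eq_sym (negbTE nij) normr0 expr0n.
rewrite ej sqfnorm_ge0 /= -[leRHS]one [leRHS]sqfnorm_proj_split.
by rewrite lerDl sqfnorm_ge0.
Qed.

End OrthogonalProjector.

Lemma gram_diag m p (S : 'M[C]_(m, p)) :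
  is_diag_mx S -> S^t* *m S = diag_mx (\row_j sqcol S j).
Proof.
move=> /is_diag_mxP dS; apply/matrixP=> i j; rewrite !mxE.
case: eqVneq => [->|nij]; rewrite ?mulr1n ?mulr0n.
  by apply: eq_bigr => a _; rewrite !mxE normCKC.
apply: big1 => a _; rewrite !mxE.
have [eai|nai] := eqVneq (a : nat) i; last by rewrite dS // conjC0 mul0r.
by rewrite [S a j]dS ?mulr0 // eai.
Qed.

(** For a wide S the columns of index at least m are zero, so the order of the
    diagonal entries extends to all columns. *)
Lemma svd_sqcol_noninc m p (S : 'M[C]_(m, p)) :
  is_diag_mx S ->
  (forall (i : 'I_m) (j : 'I_p), i = j :> nat -> 0 <= S i j) ->
  (forall (i i' : 'I_m) (j j' : 'I_p), i = j :> nat -> i' = j' :> nat ->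
         (i <= i')%N -> S i' j' <= S i j) ->
  forall j j' : 'I_p, (j <= j')%N -> sqcol S j' <= sqcol S j.
Proof.
move=> /is_diag_mxP dS S0 Smono j j' lejj'.
have [ltj'm|lemj'] := ltnP j' m; last first.
  rewrite [leLHS]/sqcol big1 ?sqcol_ge0 // => i _; rewrite dS ?normr0 ?expr0n //.
  by rewrite neq_ltn (leq_trans (ltn_ord i) lemj').
have colE (a : 'I_p) (ltam : (a < m)%N) : sqcol S a = S (Ordinal ltam) a ^+ 2.
  rewrite /sqcol (bigD1 (Ordinal ltam)) //= big1 ?addr0 => [|i nia].
    by rewrite ger0_norm // S0.
  by rewrite dS ?normr0 ?expr0n.
rewrite (colE _ ltj'm) (colE _ (leq_ltn_trans lejj' ltj'm)).
by rewrite ler_sqr ?nnegrE ?S0 //; apply: Smono.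
Qed.

(** In the bases of the SVD the approximation is Z'.  It vanishes on the range
    of E, so projecting the error by E leaves S E, and Z' enters the bound only
    through the trace of E, that is, through its rank. *)
Theorem eckart_young_ge m p k (B Z : 'M[C]_(m, p)) U S V :
  is_svd B U S V -> (\rank Z <= k)%N -> sqtail k S <= sqfnorm (B - Z).
Proof.
case=> uU uV BE dS [S0 Smono] rZ.
have uVa : V^t* \is unitarymx by rewrite trmxC_unitary.
pose Z' := U^t* *m Z *m V.
have -> : sqfnorm (B - Z) = sqfnorm (S - Z').
  rewrite -(sqfnorm_unitaryl (S - Z') uU) -[RHS](sqfnorm_unitaryr _ uVa).
  rewrite mulmxBr mulmxBl -BE /Z' !mulmxA (unitarymxP uU) mul1mx.
  by rewrite -mulmxA (unitarymxP uV) mulmx1.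
have rZ' : (\rank Z' <= k)%N.
  by apply: leq_trans rZ; rewrite (leq_trans (mxrankM_maxl _ _)) ?mxrankM_maxr.
have [E [Eadj Eidem ZE trE]] := row_null_projector Z'.
rewrite (sqfnorm_proj_split Eadj Eidem) mulmxBl ZE subr0.
apply: (@le_trans _ _ (sqfnorm (S *m E))); last by rewrite lerDl sqfnorm_ge0.
rewrite sqfnorm_projE // mxtrace_mulC mulmxA gram_diag //.
have -> : \tr (diag_mx (\row_j sqcol S j) *m E) = \sum_j sqcol S j * E j j.
  by apply: eq_bigr => j _; rewrite mul_diag_mx !mxE.
apply: sum_tail_le_weighted => [j|||]; first exact: sqcol_ge0.
- exact: svd_sqcol_noninc.
- exact: proj_diag.
- by rewrite -/(\tr E) trE ler_nat leq_sub2l.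
Qed.

Lemma sqfnorm_copid m p k (S : 'M[C]_(m, p)) :
  sqfnorm (S *m copid_mx k) = sqtail k S.
Proof.
rewrite /sqfnorm exchange_big /= /sqtail [RHS]big_mkcond; apply: eq_bigr => j _.
case: leqP => [lekj|ltjk].
  apply: eq_bigr => i _; congr (`|_| ^+ 2).
  rewrite mulmxBr mulmx1 !mxE big1 ?subr0 // => a _.
  rewrite !mxE; case: (a =P j :> nat) => [->|_] /=; rewrite ?mulr0 //.
  by rewrite ltnNge lekj mulr0.
apply: big1 => i _; rewrite mulmxBr mulmx1 !mxE (bigD1 j) //= big1 => [|a naj].
  by rewrite !mxE eqxx ltjk mulr1 addr0 subrr normr0 expr0n.
by rewrite !mxE (inj_eq val_inj) (negbTE naj) mulr0.
Qed.

(** The competitor is written as a product with inner dimension k, the form in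
    which the tensor approximation problem presents its candidates; k may
    exceed m or p. *)
Lemma eckart_young_truncation m p k (B : 'M[C]_(m, p)) U S V :
  is_svd B U S V ->
  sqfnorm (B - (U *m S *m (pid_mx k : 'M_(p, k)))
               *m ((pid_mx k : 'M_(k, p)) *m V^t*)) = sqtail k S.
Proof.
case=> uU uV BE _ _.
have uVa : V^t* \is unitarymx by rewrite trmxC_unitary.
have -> : (U *m S *m (pid_mx k : 'M_(p, k))) *m ((pid_mx k : 'M_(k, p)) *m V^t*)
  = U *m (S *m pid_mx k) *m V^t*.
  by rewrite mulmxA -(mulmxA (U *m S)) pid_mx_id // -!mulmxA.
rewrite BE -mulmxBl sqfnorm_unitaryr // -mulmxBr sqfnorm_unitaryl //.
by rewrite -sqfnorm_copid mulmxBr mulmx1.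
Qed.

(** B approximates itself with rank at most t and error 0, so the Eckart-Young
    bound leaves no room for further singular values. *)
Lemma svd_tail0 m p t (B : 'M[C]_(m, p)) U S V :
  is_svd B U S V -> (\rank B <= t)%N ->
  forall i (j : 'I_p), (t <= j)%N -> S i j = 0.
Proof.
move=> svd rB i j letj.
have := eckart_young_ge svd rB; rewrite subrr.
have -> : sqfnorm (0 : 'M[C]_(m, p)) = 0.
  by rewrite -(scale0r 0) sqfnormZ normr0 expr0n mul0r.
move=> tail_le0; have /eqP : sqtail t S == 0.
  by rewrite eq_le tail_le0 sumr_ge0 // => a _; apply: sqcol_ge0.
move/psumr_eq0P => /(_ (fun a _ => sqcol_ge0 S a) j letj).
move/psumr_eq0P => /(_ (fun a _ => exprn_ge0 _ (normr_ge0 _)) i isT) /eqP.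
by rewrite expf_eq0 normr_eq0 => /eqP.
Qed.

(** Cutting the block at t drops only columns that vanish already. *)
Lemma sqfnorm_diag_block m p k t (S : 'M[C]_(m, p)) : is_diag_mx S ->
  (forall i (j : 'I_p), (t <= j)%N -> S i j = 0) ->
  sqfnorm (\matrix_(i, j)
     if (k <= i < t)%N && (k <= j < t)%N then S i j else 0) = sqtail k S.
Proof.
move=> /is_diag_mxP dS S0.
rewrite /sqfnorm exchange_big /= /sqtail [RHS]big_mkcond; apply: eq_bigr => j _.
case: leqP => [lekj|ltjk]; last first.
  by apply: big1 => i _; rewrite mxE [(k <= j)%N]leqNgt ltjk andbF normr0 expr0n.
apply: eq_bigr => i _; rewrite mxE; have [letj|ltjt] := leqP t j.
  by rewrite !andbF S0.
by case: (eqVneq (i : nat) j) => [->|/dS->]; rewrite ?lekj ?ltjt ?if_same.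
Qed.

End EckartYoung.

(** * Tensors in the transform domain *)

Section Tensors.
Local Open Scope sesquilinear_scope.
Set Implicit Arguments.
Unset Strict Implicit.
Variable C : numClosedFieldType.

Definition sqtfnorm m p n (T : tensor C m p n) : C := \sum_k sqfnorm (T k).

Lemma sqtfnorm_ge0 m p n (T : tensor C m p n) : 0 <= sqtfnorm T.
Proof. by apply: sumr_ge0 => k _; apply: sqfnorm_ge0. Qed.

Lemma le_tfnorm m p q r n n' (T : tensor C m p n) (T' : tensor C q r n') :
  (tfnorm T <= tfnorm T') = (sqtfnorm T <= sqtfnorm T').
Proof. by rewrite ler_sqrtC // qualifE /= sqtfnorm_ge0. Qed.

Lemma mode3E m p n (T : tensor C m p n) (M : 'M[C]_n) k i j :
  mode3 T M k i j = \sum_a M k a * T a i j.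
Proof. by rewrite ffunE summxE; apply: eq_bigr => a _; rewrite mxE. Qed.

Lemma mode3_comp m p n (T : tensor C m p n) (M N : 'M[C]_n) :
  mode3 (mode3 T M) N = mode3 T (N *m M).
Proof.
apply/ffunP=> k; apply/matrixP=> i j; rewrite !mode3E.
under eq_bigr do rewrite mode3E mulr_sumr.
rewrite exchange_big; apply: eq_bigr => a _; rewrite mxE mulr_suml.
by apply: eq_bigr => b _; rewrite mulrA.
Qed.

Lemma mode3_1 m p n (T : tensor C m p n) : mode3 T 1%:M = T.
Proof.
apply/ffunP=> k; apply/matrixP=> i j; rewrite mode3E (bigD1 k) //= big1 => [|a nak].
  by rewrite mxE eqxx mul1r addr0.
by rewrite mxE eq_sym (negbTE nak) mul0r.
Qed.

Lemma mode3B m p n (T T' : tensor C m p n) (M : 'M[C]_n) k :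
  mode3 (T - T') M k = mode3 T M k - mode3 T' M k.
Proof.
rewrite !ffunE -sumrB.
by apply: eq_bigr => a _; rewrite !ffunE scalerBr.
Qed.

(** The transform acts on each tube as multiplication by c W, and W is an
    isometry. *)
Lemma sqtfnorm_mode3 m p n (T : tensor C m p n) c (W : 'M[C]_n) :
  W \is unitarymx -> sqtfnorm (mode3 T (c *: W)) = `|c| ^+ 2 * sqtfnorm T.
Proof.
move=> uW; rewrite /sqtfnorm /sqfnorm.
have tubes (X : tensor C m p n) : \sum_k \sum_i \sum_j `|X k i j| ^+ 2 =
    \sum_i \sum_j sqfnorm (\col_k X k i j).
  rewrite exchange_big; apply: eq_bigr => i _.
  rewrite exchange_big; apply: eq_bigr => j _.
  by apply: eq_bigr => k _; rewrite big_ord1 mxE.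
rewrite !tubes mulr_sumr; apply: eq_bigr => i _; rewrite mulr_sumr.
apply: eq_bigr => j _; rewrite -(sqfnorm_unitaryl (\col_k T k i j) uW) -sqfnormZ.
congr (sqfnorm _); apply/matrixP => k o; rewrite !mxE mode3E mulr_sumr.
by apply: eq_bigr => a _; rewrite !mxE mulrA.
Qed.

Section TransformDomain.
Variables (n : nat) (M : 'M[C]_n).
Hypothesis Munit : M \in unitmx.

Lemma mode3K m p (T : tensor C m p n) : mode3 (mode3 T M) (invmx M) = T.
Proof. by rewrite mode3_comp mulVmx // mode3_1. Qed.

Lemma mode3KV m p (T : tensor C m p n) : mode3 (mode3 T (invmx M)) M = T.
Proof. by rewrite mode3_comp mulmxV // mode3_1. Qed.

Lemma mode3_starM m p q (X : tensor C m p n) (Y : tensor C p q n) k :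
  mode3 (starM M X Y) M k = mode3 X M k *m mode3 Y M k.
Proof. by rewrite mode3KV ffunE. Qed.

End TransformDomain.

(** The t-rank is read off an SVD unrelated to the given one; the rank of the
    transformed slices is the invariant that carries it over. *)
Lemma trank_bound m p n (M : 'M[C]_n) (T : tensor C m p n) t :
  is_trank M T t -> forall k, (\rank (mode3 T M k) <= t)%N.
Proof.
case=> U [S [V [[_ svd] tE]]] k; case: (svd k) => _ _ -> /is_diag_mxP dS _.
apply: leq_trans (mxrankM_maxl _ _) _; apply: leq_trans (mxrankM_maxr _ _) _.
apply: rank_diag_le (eq_leq tE) => i j Sij; rewrite inE /=.
apply/andP; split; first by apply: contraNT Sij => /dS ->.
apply: contraNT Sij; rewrite negb_exists => /forallP S0.
rewrite mode3E big1 // => a _; move: (S0 a); rewrite negbK => /eqP->.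
by rewrite mulr0.
Qed.

(** Eckart-Young slice by slice in the transform domain: the lower bound for
    the factors X and Y of the minimizer, the truncated slices as competitor
    for the converse. *)
Theorem best_trank_approx_error m p n k t (M W : 'M[C]_n) c (T : tensor C m p n)
    U S V Tk :
  c != 0 -> W \is unitarymx -> M = c *: W -> is_trank M T t ->
  is_tsvdm M T U S V -> is_best_trank_approx M T k Tk ->
  tfnorm (diag_block k t S) = tfnorm (T - Tk).
Proof.
move=> c0 uW ME trT [_ svd] [[X [Y ->]] Tmin].
have Munit : M \in unitmx by rewrite ME unitmxZ ?unitfE // unitarymx_unit.
have cn : 0 < `|c| ^+ 2 by rewrite exprn_gt0 ?normr_gt0.
have hatN q r (Z : tensor C q r n) : `|c| ^+ 2 * sqtfnorm Z = sqtfnorm (mode3 Z M).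
  by rewrite ME sqtfnorm_mode3.
have blockE : sqtfnorm (mode3 (diag_block k t S) M) = \sum_a sqtail k (mode3 S M a).
  apply: eq_bigr => a _.
  have [_ _ _ dS _] := svd a.
  rewrite -(sqfnorm_diag_block k dS (svd_tail0 (svd a) (trank_bound trT a))).
  congr (sqfnorm _); apply/matrixP=> i j; rewrite [RHS]mxE !mode3E.
  under eq_bigr do rewrite ffunE mxE.
  by case: ifP => _ //; rewrite big1 // => b _; rewrite mulr0.
apply/eqP; rewrite eq_le !le_tfnorm; apply/andP; split.
  rewrite -(ler_pM2l cn) !hatN blockE; apply: ler_sum => a _.
  rewrite mode3B mode3_starM //.
  apply: eckart_young_ge (svd a) _.
  by rewrite (leq_trans (mxrankM_maxl _ _)) ?rank_leq_col.
pose X' : tensor C m k n :=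
  mode3 [ffun a => mode3 U M a *m mode3 S M a *m pid_mx k] (invmx M).
pose Y' : tensor C k p n :=
  mode3 [ffun a => pid_mx k *m (mode3 V M a)^t*] (invmx M).
have := Tmin X' Y'; rewrite le_tfnorm => /le_trans; apply.
rewrite -(ler_pM2l cn) !hatN blockE; apply: ler_sum => a _.
rewrite mode3B mode3_starM // !mode3KV // [X in X *m _]ffunE [X in _ *m X]ffunE.
by rewrite eckart_young_truncation.
Qed.

(** * Comparison with the unfolded matrix *)

Definition fold_tensor m n l (A : 'M[C]_(n * m, l)) : tensor C m l n :=
  [ffun k => \matrix_(i, j) A (mxvec_index k i) j].

Lemma sqfnorm_fold m n l (D : 'I_l -> 'M[C]_(m, n)) (A : 'M[C]_(n * m, l)) :
  sqfnorm (vec_matrix D - A) = sqtfnorm (slice_tensor D - fold_tensor A).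
Proof.
rewrite {1}/sqfnorm (reindex _ (curry_mxvec_bij _ _)) /=.
pose F k i := \sum_j `|(vec_matrix D - A) (mxvec_index k i) j| ^+ 2.
rewrite (eq_bigr (fun ki => F ki.1 ki.2)) => [|[] //]; rewrite -(pair_bigA _ F).
apply: eq_bigr => k _; apply: eq_bigr => i _; apply: eq_bigr => j _.
by rewrite !ffunE !mxE mxvecE mxE.
Qed.

(** If A = P Q, the transformed slices of the folded tensor are combinations of
    the row blocks of P, multiplied by the constant right factor Q. *)
Lemma fold_starM m n l k (M : 'M[C]_n) (A : 'M[C]_(n * m, l)) :
  M \in unitmx -> (\rank A <= k)%N ->
  exists (X : tensor C m k n) (Y : tensor C k l n), fold_tensor A = starM M X Y.
Proof.
move=> Munit /rank_factor[P [Q AE]].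
exists (fold_tensor P), (mode3 [ffun=> Q] (invmx M)).
rewrite -[LHS](mode3K Munit); congr (mode3 _ _); apply/ffunP=> a.
rewrite [RHS]ffunE mode3KV // [X in _ *m X]ffunE.
rewrite [LHS]ffunE [X in X *m _]ffunE mulmx_suml; apply: eq_bigr => b _.
rewrite -scalemxAl; congr (_ *: _); apply/matrixP=> i j.
by rewrite !ffunE AE !mxE; apply: eq_bigr => o _; rewrite mxE.
Qed.

Theorem best_trank_approx_le m n l k (M : 'M[C]_n) (D : 'I_l -> 'M[C]_(m, n))
    (A : 'M[C]_(n * m, l)) (Tk : tensor C m l n) :
  M \in unitmx -> (\rank A <= k)%N ->
  is_best_trank_approx M (slice_tensor D) k Tk ->
  tfnorm (slice_tensor D - Tk) <= fnorm (vec_matrix D - A).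
Proof.
move=> Munit rA [_ Tmin].
have [X [Y AE]] := fold_starM Munit rA.
by apply: le_trans (Tmin X Y) _; rewrite -AE /tfnorm -/(sqtfnorm _) -sqfnorm_fold.
Qed.

End Tensors.

Theorem theorem6p3 (R : realType) (m n l : nat) (hmn : (l < m * n)%N)
    (D : 'I_l -> 'M[R[i]]_(m, n))
    (M : 'M[R[i]]_n) (c : R[i]) (W : 'M[R[i]]_n)
    (hc : c != 0) (hW : W \is unitarymx) (hM : M = c *: W)
    (t : nat) (ht : is_trank M (slice_tensor D) t)
    (U : tensor R[i] m m n) (S : tensor R[i] m l n) (V : tensor R[i] l l n)
    (hS : is_tsvdm M (slice_tensor D) U S V)
    (k : nat) (hk : (k <= \rank (vec_matrix D))%N)
    (Ak : 'M[R[i]]_(n * m, l))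
    (hAk : is_best_rank_approx (vec_matrix D) k Ak)
    (TAk : tensor R[i] m l n)
    (hTAk : is_best_trank_approx M (slice_tensor D) k TAk) :
  tfnorm (diag_block k t S) = tfnorm (slice_tensor D - TAk) /\
  tfnorm (slice_tensor D - TAk) <= fnorm (vec_matrix D - Ak).
Proof.
split; first exact: best_trank_approx_error hc hW hM ht hS hTAk.
apply: best_trank_approx_le hTAk; last by case: hAk.
by rewrite hM unitmxZ ?unitfE // unitarymx_unit.
Qed.
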